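(* For every integer $\Delta\ge 1$ there exist a constant $c_\Delta\le e$ and an open set $U\subset\mathbb{C}$ containing the real interval $[0,1)$ such that the following holds. For every (simple) graph $G=(V,E)$ of maximum degree at most $\Delta$, every integer $k\ge k_\Delta:=\lceil c_\Delta\Delta+1\rceil$, and every choice of edge weights $(w_e)_{e\in E}$ with $w_e\in U$ for all $e\in E$, we have \[\mathbf{Z}(G;k,(w_e)_{e\in E})\neq 0.\] Moreover, for $\Delta=3,4,5,6,7,8,9,10,11,12$ one may take $c_\Delta\le 1.485, 1.749, 1.939, 2.081, 2.193, 2.283, 2.357, 2.419, 2.472, 2.517$ respectively, giving $k_\Delta=6,8,11,14,17,20,23,26,29,32$ respectively.
   Context: $e$ denotes the base of the natural logarithm and $[k]=\{1,\dots,k\}$. For a graph $G=(V,E)$, an integer $k\ge1$ and complex edge weights $(w_e)_{e\in E}$, the (multivariate) Potts model partition function is \[\mathbf{Z}(G;k,(w_e)_{e\in E})=\sum_{\phi:V\to[k]}\ \prod_{uv\in E,\ \phi(u)=\phi(v)} w_{uv}.\] *)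

(* Defs.v *)
From Stdlib Require Import Reals.
From mathcomp Require Import all_boot.

Set Implicit Arguments.
Unset Strict Implicit.
Unset Printing Implicit Defensive.

Local Open Scope R_scope.

Definition Cplx : Type := (R * R)%type.
Definition C0 : Cplx := (0, 0).
Definition C1 : Cplx := (1, 0).
Definition Cadd (a b : Cplx) : Cplx := (fst a + fst b, snd a + snd b).
Definition Cmul (a b : Cplx) : Cplx :=
  (fst a * fst b - snd a * snd b, fst a * snd b + snd a * fst b).
Definition Cdist (a b : Cplx) : R :=
  sqrt ((fst a - fst b) ^ 2 + (snd a - snd b) ^ 2).

Definition C_open (U : Cplx -> Prop) : Prop :=
  forall z, U z -> exists eps : R, 0 < eps /\
    forall z', Cdist z' z < eps -> U z'.

Local Close Scope R_scope.

Definition simple_graph (n : nat) (g : rel 'I_n) : Prop :=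
  irreflexive g /\ symmetric g.

Definition max_deg_le (n : nat) (g : rel 'I_n) (D : nat) : Prop :=
  forall v : 'I_n, (#|[pred u | g v u]| <= D)%N.

(* Multivariate Potts partition function.  Each edge {u,v} is counted once,
   as the ordered pair (u,v) with u < v, and carries weight w u v.
   Colourings are maps phi : V -> [k], represented as {ffun 'I_n -> 'I_k}. *)
Definition potts_Z (n : nat) (g : rel 'I_n) (k : nat) (w : 'I_n -> 'I_n -> Cplx) : Cplx :=
  \big[Cadd/C0]_(phi : {ffun 'I_n -> 'I_k})
     \big[Cmul/C1]_(p : 'I_n * 'I_n |
                     [&& g p.1 p.2, (nat_of_ord p.1 < nat_of_ord p.2)%N & phi p.1 == phi p.2])
        w p.1 p.2.

(* Main.v *)
(* The conclusion holds for every [k >= 2 * D]. The complex partition function is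
   compared with the one for nearby real weights in [0,1], by induction on the
   number of vertices, for graphs whose vertices carry colour-dependent activities
   (which absorb neighbours of fixed colour). The quantity controlled is the
   quotient Z(complex) / Z(real): recolouring a pinned leaf attached to a vertex
   of degree at most D - 1 changes it by a factor within [eps] of 1. Recolouring
   all neighbours of a vertex one at a time costs (1 + eps)^(D-1) - 1, and passing
   to the quotient for a leaf at that vertex divides this by D, because a colour
   of the vertex has real marginal probability at most 1/D once one other colour
   is forbidden; since (D-1)/D < 1 the bound [eps] reproduces itself. *)
Require Import Defs.
From HB Require Import structures.
From Stdlib Require Import Reals Lra.
From mathcomp Require Import all_boot.
From Coquelicot Require Import Complex.

Set Implicit Arguments.
Unset Strict Implicit.
Unset Printing Implicit Defensive.

Local Open Scope R_scope.

(** * Partition functions over a commutative semiring: eliminating vertices in any order *)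

Lemma big_mulr (A : Type) (zero one : A) (mul : Monoid.com_law one)
    (add : Monoid.add_law zero mul) (mulm0 : right_zero zero mul)
    (I : finType) (P : pred I) (F : I -> A) x :
  mul x (\big[add/zero]_(i | P i) F i) = \big[add/zero]_(i | P i) mul x (F i).
Proof. by apply: (big_morph (mul x)) => // y z; rewrite Monoid.mulmDr. Qed.

Section PartitionFunction.
Variables (A : Type) (zero one : A).
Variables (mul : Monoid.com_law one) (add : Monoid.add_law zero mul).
Hypothesis mulm0 : right_zero zero mul.
Variables (V : eqType) (K : finType) (g : rel V) (w : V -> V -> A).
Implicit Types (a b : V -> K -> A) (s : seq V) (P : pred V) (W : V -> A).

(* Effect of joining every vertex [v] of [P] by an edge of weight [W v] to a
   new vertex of fixed colour [c]. *)
Definition attach W P (c : K) a : V -> K -> A :=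
  fun v x => if P v && (x == c) then mul (a v x) (W v) else a v x.

(* Partition function of the subgraph induced on the vertices in [s], where a
   vertex [v] of colour [c] contributes the factor [a v c]. *)
Fixpoint pf s a : A :=
  if s is u :: s' then
    \big[add/zero]_(c : K) mul (a u c) (pf s' (attach (w u) (g u) c a))
  else one.

Lemma eq_pf s a b :
  {in s, forall v c, a v c = b v c} -> pf s a = pf s b.
Proof.
elim: s a b => //= u s IHs a b eq_ab; apply: eq_bigr => c _.
rewrite eq_ab ?mem_head //; congr (mul _ _); apply: IHs => v v_s x.
by rewrite /attach eq_ab // in_cons v_s orbT.
Qed.

Lemma attachC W P c W' P' c' a v x :
  attach W P c (attach W' P' c' a) v x = attach W' P' c' (attach W P c a) v x.
Proof.
by rewrite /attach; do 2!case: ifP => //; rewrite Monoid.mulmAC.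
Qed.

Lemma attach_cons W u (t : seq V) (c : K) a v x : u \notin t ->
  attach W (mem (u :: t)) c a v x =
  attach W (pred1 u) c (attach W (mem t) c a) v x.
Proof.
move=> u_t; rewrite /attach /= in_cons; have [->|//] := eqVneq v u.
by rewrite (negbTE u_t).
Qed.

Hypotheses (g_sym : symmetric g) (w_sym : forall u v, w u v = w v u).

(** Both sides sum over the colours of [u] and [v]. The weight of the edge [uv] is absorbed at [v]
    on the left and at [u] on the right; symmetry of [g] and [w] makes the two agree. *)
Lemma pf_swap u v s a : pf [:: u, v & s] a = pf [:: v, u & s] a.
Proof.
rewrite /=.
under eq_bigr do rewrite big_mulr //=.
rewrite exchange_big /=; apply: eq_bigr => d _.
rewrite big_mulr //; apply: eq_bigr => c _ /=.
rewrite (@eq_pf s _ (attach (w u) (g u) c (attach (w v) (g v) d a))); last first.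
  by move=> ? _ ?; rewrite attachC.
rewrite !Monoid.mulmA; congr (mul _ _).
rewrite /attach (g_sym v) (eq_sym c) (w_sym v); case: ifP => _.
  exact: Monoid.mulmCA.
exact: Monoid.mulmC.
Qed.

(** Repeated swaps bring [u] to the front, so any vertex may be eliminated first. *)
Lemma pf_rem u s a : u \in s ->
  pf s a = \big[add/zero]_(c : K)
             mul (a u c) (pf (rem u s) (attach (w u) (g u) c a)).
Proof.
move=> u_s; rewrite -[RHS]/(pf (u :: rem u s) a).
elim: s a u_s => //= v s IHs a; rewrite in_cons eq_sym.
have [->//|v_u /= u_s] := eqVneq v u.
rewrite -[RHS]/(pf [:: u, v & rem u s] a) pf_swap.
by apply: eq_bigr => c _; rewrite IHs.
Qed.

(** [attach W (pred1 u) c] models a pinned leaf at [u]. When [u] is eliminated with colour [d], the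
    leaf contributes only the factor [W u], and only for [d == c]; uniqueness of [s] keeps [u] out
    of [rem u s]. *)
Lemma pf_leaf W u s c a : uniq s -> u \in s ->
  pf s (attach W (pred1 u) c a) =
  \big[add/zero]_(d : K) mul (if d == c then mul (a u d) (W u) else a u d)
                             (pf (rem u s) (attach (w u) (g u) d a)).
Proof.
move=> s_uniq u_s; rewrite (pf_rem _ u_s); apply: eq_bigr => d _.
rewrite {1}/attach /= eqxx /=; congr (mul _ _).
apply: eq_pf => v v_s x; rewrite attachC /attach.
have /negbTE-> : ~~ pred1 u v; last by [].
by apply: contraTneq v_s => ->; rewrite mem_rem_uniq // inE eqxx.
Qed.

End PartitionFunction.

(** * Expansion of the recursive partition function as a sum over colourings *)

Section Colourings.
Variables (A : Type) (zero one : A).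
Variables (mul : Monoid.com_law one) (add : Monoid.add_law zero mul).
Hypothesis mulm0 : right_zero zero mul.
Variables (n : nat) (K : finType) (g : rel 'I_n) (w : 'I_n -> 'I_n -> A).
Implicit Types (a : 'I_n -> K -> A) (s : seq 'I_n) (phi : {ffun 'I_n -> K}).

(** The term of a single colouring in the expansion of [pf], kept in the same recursive form so that
    both unfold together. *)
Fixpoint colouring_weight s a phi : A :=
  if s is u :: s' then
    mul (a u (phi u)) (colouring_weight s' (attach mul (w u) (g u) (phi u) a) phi)
  else one.

Lemma eq_colouring_weight s a (phi psi : {ffun 'I_n -> K}) :
  {in s, phi =1 psi} -> colouring_weight s a phi = colouring_weight s a psi.
Proof.
elim: s a => //= u s IHs a eq_phi.
rewrite eq_phi ?mem_head //; congr (mul _ _); apply: IHs => v v_s.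
by apply: eq_phi; rewrite in_cons v_s orbT.
Qed.

(** Colourings of [s] are encoded as total functions with the default colour [c0] outside [s], so
    that each is counted once. The induction splits the sum by the colour of the head. *)
Lemma pf_colourings (c0 : K) s a : uniq s ->
  pf add g w s a =
  \big[add/zero]_(phi : {ffun 'I_n -> K} | [forall v, (v \notin s) ==> (phi v == c0)])
     colouring_weight s a phi.
Proof.
elim: s a => [|u s IHs] a /=.
  move=> _; rewrite (big_pred1 [ffun=> c0]) // => phi; apply/forallP/eqP.
    by move=> phiE; apply/ffunP => v; rewrite ffunE; apply/eqP/phiE.
  by move=> -> v; rewrite ffunE eqxx.
move=> /andP[u_s s_uniq]; rewrite [RHS](partition_big (fun phi => phi u) predT) //=.
apply: eq_bigr => c _; rewrite IHs // big_mulr //=.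
(* Overwriting the colour of [u] by [c], or back by [c0], is the bijection between colourings of
   [u :: s] with [u] coloured [c] and colourings of [s]. *)
pose upd phi x := [ffun v => if v == u then x else phi v] : {ffun 'I_n -> K}.
rewrite [RHS](reindex_onto (fun phi => upd phi c) (fun phi => upd phi c0)) /=; last first.
  move=> phi /andP[_ /eqP phi_u]; apply/ffunP => v; rewrite !ffunE.
  by case: eqP => // ->.
apply: eq_big => [phi|phi phi0]; last first.
  rewrite !ffunE eqxx; congr (mul _ _); apply: eq_colouring_weight => v v_s.
  by rewrite ffunE ifN //; apply: contraNneq u_s => <-.
apply/forallP/idP => [phi0|/andP[/andP[/forallP phi0 _] /eqP phiE] v].
  rewrite !ffunE eqxx eqxx andbT; apply/andP; split.
    apply/forallP => v; rewrite ffunE in_cons negb_or; apply/implyP => /andP[vu vs].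
    by rewrite (negbTE vu) (implyP (phi0 v)).
  apply/eqP/ffunP => v; rewrite !ffunE; case: eqP => // ->.
  by rewrite (eqP (implyP (phi0 u) u_s)).
apply/implyP => v_s; rewrite -phiE !ffunE; have [//|v_u] := eqVneq v u.
by have := implyP (phi0 v); rewrite ffunE (negbTE v_u) in_cons negb_or v_u; apply.
Qed.

(** In an increasing list the vertex eliminated first is the smaller end of each edge, so every
    monochromatic edge is counted once, in the orientation used by [potts_Z]. *)
Lemma colouring_weightE s a phi : sorted (fun u v : 'I_n => (u < v)%N) s ->
  colouring_weight s a phi =
  mul (\big[mul/one]_(v <- s) a v (phi v))
      (\big[mul/one]_(u <- s) \big[mul/one]_(v <- s |
          [&& g u v, (u < v)%N & phi u == phi v]) w u v).
Proof.
elim: s a => [|u s IHs] a /=; first by rewrite !big_nil Monoid.mulm1.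
move=> s_path; rewrite IHs ?(path_sorted s_path) //.
have lt_u : {in s, forall v : 'I_n, (u < v)%N}.
  by apply/allP; apply: order_path_min s_path => x y z; apply: ltn_trans.
rewrite !big_cons ltnn andbF -!Monoid.mulmA; congr (mul _ _).
have -> : \big[mul/one]_(v <- s) attach mul (w u) (g u) (phi u) a v (phi v) =
  mul (\big[mul/one]_(v <- s) a v (phi v))
      (\big[mul/one]_(v <- s | [&& g u v, (u < v)%N & phi u == phi v]) w u v).
  rewrite [X in mul _ X]big_mkcond -big_split /=; apply: eq_big_seq => v v_s.
  rewrite lt_u // /attach eq_sym /=; case: ifP => //; by rewrite Monoid.mulm1.
rewrite -!Monoid.mulmA; do 2!congr (mul _ _); apply: eq_big_seq => v v_s.
by rewrite big_cons [(v < u)%N]ltnNge (ltnW (lt_u v v_s)) andbF.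
Qed.

Lemma pf_enum (c0 : K) :
  \big[add/zero]_(phi : {ffun 'I_n -> K})
     \big[mul/one]_(p : 'I_n * 'I_n |
        [&& g p.1 p.2, (p.1 < p.2)%N & phi p.1 == phi p.2]) w p.1 p.2 =
  pf add g w (enum 'I_n) (fun _ (_ : K) => one).
Proof.
rewrite (pf_colourings c0) ?enum_uniq //; apply: eq_big => [phi|phi _].
  by apply/esym/forallP => v; rewrite mem_enum.
rewrite colouring_weightE; last first.
  by have := iota_ltn_sorted 0 n; rewrite -val_enum_ord sorted_map.
rewrite [X in mul X _]big1 // Monoid.mul1m !big_enum /=.
under [RHS]eq_bigr do rewrite big_enum_cond /=.
by rewrite pair_big_dep.
Qed.

End Colourings.

(** * Real and complex finite sums *)

HB.instance Definition _ := Monoid.isComLaw.Build R 0 Rplus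
  (fun x y z => esym (Rplus_assoc x y z)) Rplus_comm Rplus_0_l.
HB.instance Definition _ := Monoid.isComLaw.Build R 1 Rmult
  (fun x y z => esym (Rmult_assoc x y z)) Rmult_comm Rmult_1_l.
HB.instance Definition _ := Monoid.isAddLaw.Build R Rmult Rplus
  (fun x y z => Rmult_plus_distr_r x y z) Rmult_plus_distr_l.
HB.instance Definition _ := Monoid.isComLaw.Build C (RtoC 0) Cplus
  Cplus_assoc Cplus_comm Cplus_0_l.
HB.instance Definition _ := Monoid.isComLaw.Build C (RtoC 1) Cmult
  Cmult_assoc Cmult_comm Cmult_1_l.
HB.instance Definition _ := Monoid.isAddLaw.Build C Cmult Cplus
  Cmult_plus_distr_r Cmult_plus_distr_l.

Section FiniteSums.
Variable I : finType.
Implicit Types (F G : I -> R) (P : pred I).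

Lemma rsum_le P F G : (forall i, P i -> F i <= G i) ->
  \big[Rplus/0]_(i | P i) F i <= \big[Rplus/0]_(i | P i) G i.
Proof. by move=> leFG; elim/big_ind2: _ => // [|*]; lra. Qed.

Lemma rsum_ge0 P F : (forall i, P i -> 0 <= F i) -> 0 <= \big[Rplus/0]_(i | P i) F i.
Proof. by move=> F0; elim/big_ind: _ => // [|*]; lra. Qed.

Lemma rsumD F G :
  \big[Rplus/0]_i (F i + G i) = \big[Rplus/0]_i F i + \big[Rplus/0]_i G i.
Proof. by elim/big_rec3: _ => [|i x y z _ ->]; lra. Qed.

Lemma rsumB F G :
  \big[Rplus/0]_i (F i - G i) = \big[Rplus/0]_i F i - \big[Rplus/0]_i G i.
Proof.
by elim/big_rec3: _ => [|i x y z _ ->]; lra.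
Qed.

Lemma rsumM P x F :
  x * \big[Rplus/0]_(i | P i) F i = \big[Rplus/0]_(i | P i) (x * F i).
Proof. exact: (big_mulr Rplus Rmult_0_r). Qed.

Lemma csumM x (F : I -> C) :
  (x * \big[Cplus/RtoC 0]_i F i = \big[Cplus/RtoC 0]_i (x * F i))%C.
Proof. exact: (big_mulr Cplus Cmult_0_r). Qed.

Lemma csumD (F G : I -> C) :
  (\big[Cplus/RtoC 0]_i (F i + G i) =
   \big[Cplus/RtoC 0]_i F i + \big[Cplus/RtoC 0]_i G i)%C.
Proof. by elim/big_rec3: _ => [|i x y z _ ->]; ring. Qed.

Lemma RtoC_rsum F : RtoC (\big[Rplus/0]_i F i) = \big[Cplus/RtoC 0]_i RtoC (F i).
Proof. exact: (big_morph RtoC RtoC_plus). Qed.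

Lemma Cmod_csum (F : I -> C) :
  Cmod (\big[Cplus/RtoC 0]_i F i) <= \big[Rplus/0]_i Cmod (F i).
Proof.
elim/big_rec2: _ => [|i x y _ le_xy]; first by rewrite Cmod_0; lra.
by have := Cmod_triangle (F i) y; lra.
Qed.

Lemma rsum_const (x : R) : \big[Rplus/0]_(i : I) x = INR #|I| * x.
Proof.
rewrite big_const; elim: #|I| => [|k IHk]; first by rewrite /=; lra.
by rewrite S_INR iterS IHk; lra.
Qed.

Lemma rsum_if x (F : I -> R) c :
  \big[Rplus/0]_i (if i == c then F i * x else F i) =
  \big[Rplus/0]_i F i - (1 - x) * F c.
Proof.
rewrite (bigD1 c) //= eqxx [X in _ = X - _](bigD1 c) //=.
rewrite (eq_bigr F); last by move=> i /negbTE->.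
by lra.
Qed.

End FiniteSums.

(** * The real partition function: positivity, monotonicity and the cost of leaves *)

Definition rattach (V : eqType) (K : finType) := @attach R 1 Rmult V K.
Definition cattach (V : eqType) (K : finType) := @attach C (RtoC 1) Cmult V K.
Definition rpf (V : eqType) (K : finType) := @pf R 0 1 Rmult Rplus V K.
Definition cpf (V : eqType) (K : finType) :=
  @pf C (RtoC 0) (RtoC 1) Cmult Cplus V K.

Section RealPartitionFunction.
Variables (V : eqType) (K : finType) (g : rel V) (w : V -> V -> R).
Hypotheses (g_sym : symmetric g) (w_sym : forall u v, w u v = w v u).
Hypothesis w01 : forall u v, g u v -> 0 <= w u v <= 1.
Implicit Types (a b : V -> K -> R) (s t : seq V) (P : pred V) (W : V -> R).

Local Notation att := (@rattach V K).
Local Notation Z := (@rpf V K g w).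

Lemma rattachE W P (c : K) a v x :
  att W P c a v x = if P v && (x == c) then a v x * W v else a v x.
Proof. by []. Qed.

Lemma rattachC W P (c : K) W' P' c' a v x :
  att W P c (att W' P' c' a) v x = att W' P' c' (att W P c a) v x.
Proof. exact: attachC. Qed.

Lemma rattach_cons W u t (c : K) a v x : u \notin t ->
  att W (mem (u :: t)) c a v x = att W (pred1 u) c (att W (mem t) c a) v x.
Proof. exact: attach_cons. Qed.

Lemma eq_rpf s a b : {in s, forall v c, a v c = b v c} -> Z s a = Z s b.
Proof. exact: eq_pf. Qed.

Lemma rpf_cons u s a :
  Z (u :: s) a = \big[Rplus/0]_(c : K) (a u c * Z s (att (w u) (g u) c a)).
Proof. by []. Qed.

Lemma rpf_rem u s a : u \in s ->
  Z s a = \big[Rplus/0]_(c : K) (a u c * Z (rem u s) (att (w u) (g u) c a)).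
Proof. exact: (pf_rem Rplus Rmult_0_r g_sym w_sym). Qed.

Lemma rpf_leaf W u s c a : uniq s -> u \in s ->
  Z s (att W (pred1 u) c a) =
  Z s a - (1 - W u) * (a u c * Z (rem u s) (att (w u) (g u) c a)).
Proof.
move=> s_uniq u_s; rewrite (rpf_rem a u_s).
have -> : Z s (att W (pred1 u) c a) =
    \big[Rplus/0]_(d : K) ((if d == c then a u d * W u else a u d) *
                           Z (rem u s) (att (w u) (g u) d a)).
  exact: (pf_leaf Rplus Rmult_0_r g_sym w_sym).
rewrite -(rsum_if (W u) (fun c => a u c * Z (rem u s) (att (w u) (g u) c a))).
by apply: eq_bigr => d _; case: eqP => _ /=; ring.
Qed.

Lemma rpf_ge0 s a : {in s, forall v c, 0 <= a v c} -> 0 <= Z s a.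
Proof.
elim: s a => [|u s IHs] a a0; first by rewrite /rpf /=; lra.
rewrite rpf_cons.
apply: rsum_ge0 => c _; apply: Rmult_le_pos; first by apply: a0; rewrite mem_head.
apply: IHs => v v_s x; have := a0 v; rewrite in_cons v_s orbT => /(_ isT x) avx.
rewrite rattachE; case: ifP => // /andP[/w01 w0 _].
by apply: Rmult_le_pos; lra.
Qed.

Lemma rpf_mono s a b : {in s, forall v c, 0 <= a v c <= b v c} -> Z s a <= Z s b.
Proof.
elim: s a b => [|u s IHs] a b ab; first by rewrite /rpf /=; lra.
rewrite !rpf_cons.
have abs v c : v \in s -> 0 <= a v c <= b v c.
  by move=> v_s; apply: ab; rewrite in_cons v_s orbT.
have absa v c d : v \in s -> 0 <= att (w u) (g u) d a v c <= att (w u) (g u) d b v c.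
  move=> /abs-/(_ c) avc; rewrite !rattachE; case: ifP => // /andP[/w01 w0 _]; split.
    by apply: Rmult_le_pos; lra.
  by apply: Rmult_le_compat_r; lra.
apply: rsum_le => c _; have := ab u (mem_head _ _) c.
have : Z s (att (w u) (g u) c a) <= Z s (att (w u) (g u) c b).
  by apply: IHs => v v_s x; apply: absa.
have : 0 <= Z s (att (w u) (g u) c a).
  by apply: rpf_ge0 => v v_s x; have := absa v x c v_s; lra.
by move=> *; apply: Rmult_le_compat; lra.
Qed.

Lemma attach_bounds W P c a v x : (P v -> 0 <= W v <= 1) -> 0 <= a v x ->
  0 <= att W P c a v x <= a v x.
Proof.
move=> W01 avx; rewrite rattachE; case: ifP => [/andP[/W01 Wv _]|_]; last by lra.
by rewrite /=; split; nra.
Qed.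

Lemma rpf_attach_le W P c s a :
  {in s, forall v, P v -> 0 <= W v <= 1} -> {in s, forall v c, 0 <= a v c} ->
  Z s (att W P c a) <= Z s a.
Proof.
by move=> W01 a0; apply: rpf_mono => v v_s x; apply: attach_bounds; auto.
Qed.

(** Leaves are added one vertex at a time. The leaf of colour [c] at [u] costs at most the part
    [y c] of [Z s a] in which [u] has colour [c], and these parts sum over [c] to [Z s a]. *)
Lemma rpf_attach_sum W t s a : uniq s -> uniq t -> {subset t <= s} ->
  {in t, forall v, 0 <= W v <= 1} -> {in s, forall v c, 0 <= a v c} ->
  \big[Rplus/0]_(c : K) (Z s a - Z s (att W (mem t) c a)) <= INR (size t) * Z s a.
Proof.
move=> s_uniq; elim: t => [|u t IHt] /=.
  move=> _ _ _ _; rewrite big1 ?Rmult_0_l; first by lra.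
  by move=> c _; apply: Rminus_diag_eq; apply: eq_rpf => v _ x; rewrite rattachE /=.
move=> /andP[u_t t_uniq] ut_s W01 a0.
have u_s : u \in s by apply: ut_s; rewrite mem_head.
have t_s : {subset t <= s} by move=> v v_t; apply: ut_s; rewrite in_cons v_t orbT.
have Wt : {in t, forall v, 0 <= W v <= 1}.
  by move=> v v_t; apply: W01; rewrite in_cons v_t orbT.
have Wu : 0 <= W u <= 1 by apply: W01; rewrite mem_head.
pose y c := a u c * Z (rem u s) (att (w u) (g u) c a).
apply: (@Rle_trans _ (\big[Rplus/0]_c ((Z s a - Z s (att W (mem t) c a)) + y c))).
  apply: rsum_le => c _.
  rewrite (@eq_rpf s (att W (mem (u :: t)) c a)
             (att W (pred1 u) c (att W (mem t) c a))); last first.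
    by move=> v _ x; rewrite rattach_cons.
  rewrite rpf_leaf // (rattachE W (mem t)) /= (negbTE u_t) /=.
  have a0' : {in rem u s, forall v x, 0 <= att (w u) (g u) c a v x}.
    move=> v /mem_rem v_s x; apply: (proj1 (attach_bounds _ _ _)).
      exact: w01.
    exact: a0.
  have le_y : Z (rem u s) (att (w u) (g u) c (att W (mem t) c a)) <=
              Z (rem u s) (att (w u) (g u) c a).
    rewrite (@eq_rpf (rem u s) _ (att W (mem t) c (att (w u) (g u) c a))).
      by apply: rpf_attach_le => // v _ /Wt.
    by move=> v _ x; rewrite rattachC.
  have y0 : 0 <= Z (rem u s) (att (w u) (g u) c (att W (mem t) c a)).
    apply: rpf_ge0 => v v_s x; rewrite rattachC.
    by apply: (proj1 (attach_bounds _ _ _)); [apply: Wt | apply: a0'].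
  have := a0 u u_s c; rewrite /y.
  move=> au0; have := Rmult_le_compat_l _ _ _ au0 le_y.
  have := Rmult_le_pos _ _ au0 y0.
  by set az := a u c * Z _ (att _ _ _ (att _ _ _ _)); move: az => az; nra.
rewrite rsumD -rpf_rem //.
have := IHt t_uniq t_s Wt a0.
by case: (size t) => [|m] /=; lra.
Qed.

End RealPartitionFunction.

(** * Relative closeness of complex numbers *)

Definition near (e : R) (x y : C) := y <> RtoC 0 /\ Cmod (x - y) <= e * Cmod y.

Lemma near_refl x : x <> RtoC 0 -> near 0 x x.
Proof.
move=> x0; split=> //; have -> : (x - x = RtoC 0)%C by ring.
by rewrite Cmod_0; lra.
Qed.

(** Relative errors compound multiplicatively, since [x / z] is the product of [x / y] and
    [y / z]. *)
Lemma near_trans e f x y z : 0 <= e ->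
  near e x y -> near f y z -> near ((1 + e) * (1 + f) - 1) x z.
Proof.
move=> e0 [y0 xy] [z0 yz]; split=> //.
have := Cmod_triangle (x - y) (y - z).
have -> : (x - y + (y - z) = x - z)%C by ring.
have := Cmod_triangle (y - z) z.
have -> : (y - z + z = y)%C by ring.
by move=> ? ?; nra.
Qed.

Lemma Cmod_1D_ge z : 1 - Cmod z <= Cmod (1 + z).
Proof.
have := Cmod_triangle (1 + z) (- z).
have -> : (1 + z + - z = 1)%C by ring.
by rewrite Cmod_1 Cmod_opp; lra.
Qed.

Lemma Cmod_RtoC_mul (x : R) (z : C) : 0 <= x -> Cmod (x * z) = x * Cmod z.
Proof. by move=> x0; rewrite Cmod_mult Cmod_R Rabs_pos_eq. Qed.

(** * Contraction estimate at a single vertex *)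

Section Contraction.
(** At a vertex [u], [ar] and [ac] are the real and complex activities; [yr c] is the real partition
    function of the rest once [u] has colour [c], and [rho c] is the quotient of the complex one by
    it. [Y] will be the real partition function with [u] deleted, and [e'] the error from
    recolouring all neighbours of [u]. Then [X] and [Xc] are the two full partition functions. *)
Variables (K : finType) (ar yr : K -> R) (ac rho : K -> C) (D Y eta e' : R).
Hypotheses (D1 : 1 <= D) (Y0 : 0 < Y) (eta0 : 0 <= eta) (e'01 : 0 <= e' <= 1).
Hypothesis ar01 : forall c, 0 <= ar c <= 1.
Hypothesis ac1 : forall c, Cmod (ac c) <= 1.
Hypothesis ac_ar : \big[Rplus/0]_c Cmod (ac c - RtoC (ar c)) <= D * eta.
Hypothesis yrY : forall c, 0 <= yr c <= Y.
Hypothesis rho_near : forall c d, near e' (rho c) (rho d).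

Let x c := ar c * yr c.
Let X := \big[Rplus/0]_c x c.
Let Xc := (\big[Cplus/RtoC 0]_c (ac c * (rho c * RtoC (yr c))))%C.

Lemma x_bounds c : 0 <= x c <= Y.
Proof. by have := ar01 c; have := yrY c; rewrite /x; split; nra. Qed.

Lemma ac_ar_le c : Cmod (ac c - RtoC (ar c)) <= D * eta.
Proof.
apply: Rle_trans ac_ar; rewrite (bigD1 c) //= -[X in X <= _]Rplus_0_r.
by apply: Rplus_le_compat_l; apply: rsum_ge0 => d _; apply: Cmod_ge_0.
Qed.

(** All quotients are measured against [rho m]. [S1] collects the errors of the quotients and [S2]
    those of the activities. Since [e m] vanishes, the term of [m] drops out of [S1], leaving
    [X - x m]. *)
Lemma perturbed_sum m : exists (e : K -> C) (S1 S2 : C),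
  [/\ forall c, rho c = (rho m * (1 + e c))%C,
      e m = RtoC 0 /\ forall c, Cmod (e c) <= e',
      Cmod S1 <= e' * (X - x m),
      Cmod S2 <= (1 + e') * Y * (D * eta) &
      Xc = (rho m * (RtoC X + S1 + S2))%C].
Proof.
have rho0 c : rho c <> RtoC 0 by have [] := rho_near c c.
pose e c := (rho c / rho m - 1)%C.
have rhoE c : rho c = (rho m * (1 + e c))%C by rewrite /e; field; apply: rho0.
have em : e m = RtoC 0 by rewrite /e; field; apply: rho0.
have e_le c : Cmod (e c) <= e'.
  have [_ le_e] := rho_near c m; have m0 := proj1 (Cmod_gt_0 _) (rho0 m).
  have -> : e c = ((rho c - rho m) / rho m)%C by rewrite /e; field; apply: rho0.
  rewrite Cmod_div //; apply: (Rmult_le_reg_r (Cmod (rho m))) => //.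
  by rewrite /Rdiv Rmult_assoc Rinv_l ?Rmult_1_r //; lra.
exists e, (\big[Cplus/RtoC 0]_c (RtoC (x c) * e c)%C).
exists (\big[Cplus/RtoC 0]_c ((ac c - RtoC (ar c)) * (RtoC (yr c) * (1 + e c)))%C).
split=> //.
- apply: Rle_trans (Cmod_csum _) _.
  rewrite (bigD1 m) //= em Cmult_0_r Cmod_0 Rplus_0_l.
  have -> : X - x m = \big[Rplus/0]_(c | c != m) x c.
    by rewrite /X (bigD1 m) //=; ring.
  rewrite rsumM; apply: rsum_le => c _.
  rewrite Cmod_RtoC_mul; last by have := x_bounds c; lra.
  by have := e_le c; have := x_bounds c; nra.
- apply: Rle_trans (Cmod_csum _) _.
  apply: Rle_trans (_ : (1 + e') * Y * \big[Rplus/0]_c Cmod (ac c - RtoC (ar c)) <= _).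
    rewrite rsumM; apply: rsum_le => c _.
    rewrite Cmod_mult Cmod_RtoC_mul; last by have := yrY c; lra.
    have := Cmod_triangle 1 (e c); rewrite Cmod_1 => le1.
    rewrite [X in _ <= X]Rmult_comm; apply: Rmult_le_compat_l; first exact: Cmod_ge_0.
    have := e_le c; have := yrY c; have := Cmod_ge_0 (1 + e c); nra.
  by apply: Rmult_le_compat_l => //; nra.
rewrite /X RtoC_rsum -!csumD csumM; apply: eq_bigr => c _.
by rewrite (rhoE c) /x RtoC_mult; ring.
Qed.

(** A vanishing sum would force [X <= Cmod S1 + Cmod S2 <= (e' + 2 * eta) * X < X]. *)
Lemma perturbed_sum_neq0 (m : K) : D * Y <= X -> e' + 2 * eta < 1 -> Xc <> RtoC 0.
Proof.
move=> DYX small; have [e [S1 [S2 [rhoE _ S1_le S2_le ->]]]] := perturbed_sum m.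
have [rho0 _] := rho_near m m.
apply: Cmult_neq_0 => // /(f_equal Cmod); rewrite Cmod_0 => sum0.
have X0 : 0 < X by nra.
have := Cmod_triangle (RtoC X + S1 + S2) (- (S1 + S2)).
have -> : (RtoC X + S1 + S2 + - (S1 + S2) = RtoC X)%C by ring.
rewrite sum0 Cmod_opp Cmod_R Rabs_pos_eq; last by lra.
have := Cmod_triangle S1 S2; have := x_bounds m.
have : (1 + e') * Y * (D * eta) <= 2 * eta * X.
  have -> : (1 + e') * Y * (D * eta) = ((1 + e') * eta) * (D * Y) by ring.
  apply: Rmult_le_compat => //; nra.
by nra.
Qed.

Variables (wr : R) (wc : C).
Hypotheses (wr01 : 0 <= wr <= 1) (wc_wr : Cmod (wc - RtoC wr) <= eta).
Hypothesis DYX : forall c, D * Y <= X - x c.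

(** The real and complex partition functions after attaching a pinned leaf of colour [c], in the
    form given by [rpf_leaf] and [cpf_leaf]. *)
Let f c := X - (1 - wr) * x c.
Let fc c := (Xc - (1 - wc) * (ac c * (rho c * RtoC (yr c))))%C.

(** [x c <= Y <= D * Y <= X - x c], so one colour carries at most half of [X]. *)
Lemma f_ge c : D * Y <= f c /\ X <= 2 * f c.
Proof. by have := DYX c; have := x_bounds c; rewrite /f; nra. Qed.

Lemma leaf_activity_error c :
  Cmod ((1 - wc) * ac c - (1 - RtoC wr) * RtoC (ar c)) <= (1 + D) * eta.
Proof.
have -> : ((1 - wc) * ac c - (1 - RtoC wr) * RtoC (ar c) =
  - ((wc - RtoC wr) * ac c) + RtoC (1 - wr) * (ac c - RtoC (ar c)))%C.
  by rewrite RtoC_minus; ring.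
apply: Rle_trans (Cmod_triangle _ _) _.
rewrite Cmod_opp Cmod_mult Cmod_RtoC_mul; last by lra.
have := ac_ar_le c; have := ac1 c; have := Cmod_ge_0 (ac c).
have := Cmod_ge_0 (wc - RtoC wr); have := Cmod_ge_0 (ac c - RtoC (ar c)).
move: (Cmod (wc - _)) (Cmod (ac c)) (Cmod (ac c - _)) wc_wr => p q r p_le r0 p0 q0 q1 r1.
have : p * q <= eta by nra.
have : (1 - wr) * r <= D * eta by nra.
by lra.
Qed.

(* With [x l <= x j], normalising by [rho j] makes every error coefficient of the
   logarithmic derivative of [f j / f l] nonnegative except that of [j], whose
   error vanishes; the coefficients therefore add up to at most [x j / f l]. *)
Lemma leaf_core j l : x l <= x j -> exists Pj Pl : C,
  [/\ fc j = (rho j * (RtoC (f j) * (1 + Pj)))%C,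
      fc l = (rho j * (RtoC (f l) * (1 + Pl)))%C,
      Cmod (Pj - Pl) <= e' / D + 12 * eta,
      Cmod Pj <= 2 * e' + 6 * eta &
      Cmod Pl <= 2 * e' + 6 * eta].
Proof.
move=> xlj; have [e [S1 [S2 [rhoE [ej e_le] S1_le S2_le XcE]]]] := perturbed_sum j.
have DY0 : 0 < D * Y by nra.
(* [B c] gathers every error caused by the activities and the leaf weight, all of order [eta]; what
   remains is the error of the quotients. *)
pose B c := (S2 - ((1 - wc) * ac c - (1 - RtoC wr) * RtoC (ar c)) *
                  (RtoC (yr c) * (1 + e c)))%C.
have B_le c : Cmod (B c) <= 6 * eta * (D * Y).
  apply: Rle_trans (Cmod_triangle _ _) _.
  rewrite Cmod_opp Cmod_mult Cmod_RtoC_mul; last by have := yrY c; lra.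
  have := Cmod_triangle 1 (e c); rewrite Cmod_1 => le1.
  have := leaf_activity_error c; have := Cmod_ge_0 ((1 - wc) * ac c - (1 - RtoC wr) * RtoC (ar c)).
  move: (Cmod (_ - _)) => p p0 p_le.
  have q_le : yr c * Cmod (1 + e c) <= Y * 2.
    by apply: Rmult_le_compat; have := yrY c; have := e_le c;
       have := Cmod_ge_0 (1 + e c); lra.
  have q0 : 0 <= yr c * Cmod (1 + e c).
    by apply: Rmult_le_pos; [have := yrY c; lra | apply: Cmod_ge_0].
  have := Rmult_le_compat _ _ _ _ p0 q0 p_le q_le.
  have eY : 0 <= eta * Y by nra.
  have : (1 + D) * eta * (Y * 2) <= 4 * eta * (D * Y) by nra.
  have : (1 + e') * Y * (D * eta) <= 2 * eta * (D * Y).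
    have -> : (1 + e') * Y * (D * eta) = (1 + e') * (eta * (D * Y)) by ring.
    have -> : 2 * eta * (D * Y) = 2 * (eta * (D * Y)) by ring.
    by apply: Rmult_le_compat_r; nra.
  by lra.
have f0 c : 0 < f c by have := f_ge c; lra.
have fC0 c : RtoC (f c) <> RtoC 0 by move=> /RtoC_inj; have := f0 c; lra.
have fcE c : fc c = (rho j * (RtoC (f c) + (S1 - RtoC ((1 - wr) * x c) * e c + B c)))%C.
  rewrite /fc XcE (rhoE c) /f /B /x !RtoC_minus !RtoC_mult RtoC_minus; ring.
pose P c := ((S1 - RtoC ((1 - wr) * x c) * e c + B c) / RtoC (f c))%C.
have B_f c : Cmod (B c / RtoC (f c)) <= 6 * eta.
  rewrite Cmod_div // Cmod_R Rabs_pos_eq; last by have := f0 c; lra.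
  apply: (Rmult_le_reg_r (f c)) => //.
  rewrite /Rdiv Rmult_assoc Rinv_l ?Rmult_1_r; last by have := f0 c; lra.
  apply: Rle_trans (B_le c) _; apply: Rmult_le_compat_l; first by lra.
  by have [] := f_ge c.
have P_le c : x c <= x j -> Cmod (P c) <= 2 * e' + 6 * eta.
  move=> xc; have -> : (P c = (S1 - RtoC ((1 - wr) * x c) * e c) / RtoC (f c) + B c / RtoC (f c))%C.
    by rewrite /P; field; apply: fC0.
  apply: Rle_trans (Cmod_triangle _ _) _; apply: Rplus_le_compat (B_f c).
  rewrite Cmod_div // Cmod_R Rabs_pos_eq; last by have := f0 c; lra.
  apply: (Rmult_le_reg_r (f c)) => //.
  rewrite /Rdiv Rmult_assoc Rinv_l ?Rmult_1_r; last by have := f0 c; lra.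
  apply: Rle_trans (Cmod_triangle _ _) _.
  have x0 := x_bounds c.
  rewrite Cmod_opp Cmod_RtoC_mul; last by apply: Rmult_le_pos; lra.
  have [_ Xf] := f_ge c; have ec := e_le c; have ec0 := Cmod_ge_0 (e c).
  (* Together with [Cmod S1 <= e' * (X - x j)] this gives at most [e' * X <= 2 * e' * f c]. *)
  have : (1 - wr) * x c * Cmod (e c) <= x j * e'.
    by apply: Rmult_le_compat; nra.
  by nra.
exists (P j), (P l); split; try by [apply: P_le; lra].
- by rewrite fcE /P; congr Cmult; field; apply: fC0.
- by rewrite fcE /P; congr Cmult; field; apply: fC0.
have -> : (P j - P l = (S1 * RtoC (/ f j - / f l) + RtoC ((1 - wr) * x l / f l) * e l) +
                       (B j / RtoC (f j) - B l / RtoC (f l)))%C.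
  rewrite /P ej RtoC_minus RtoC_div ?RtoC_inv; try by have := f0 j; have := f0 l; lra.
  by field; split; apply: fC0.
have x0 := x_bounds l.
apply: Rle_trans (Cmod_triangle _ _) _; apply: Rplus_le_compat; last first.
  apply: Rle_trans (Cmod_triangle _ _) _; rewrite Cmod_opp.
  by have := B_f j; have := B_f l; lra.
have fj := f0 j; have fl := f0 l.
apply: Rle_trans (Cmod_triangle _ _) _.
rewrite Cmod_mult Cmod_R Cmod_RtoC_mul; last first.
  by apply: Rmult_le_pos; [nra | apply: Rlt_le; apply: Rinv_0_lt_compat].
have fD : / f j - / f l = (1 - wr) * (x j - x l) / (f j * f l).
  by rewrite /f; field; rewrite -/(f j) -/(f l); lra.
rewrite Rabs_pos_eq; last first.
  rewrite fD; apply: Rmult_le_pos; first by nra.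
  by apply: Rlt_le; apply: Rinv_0_lt_compat; nra.
have S1f : Cmod S1 <= e' * f j.
  apply: Rle_trans S1_le _; apply: Rmult_le_compat_l; first by lra.
  by rewrite /f; have := x_bounds j; nra.
have T1 : Cmod S1 * (/ f j - / f l) <= e' * ((1 - wr) * (x j - x l) / f l).
  apply: Rle_trans (_ : e' * f j * (/ f j - / f l) <= _).
    apply: Rmult_le_compat_r => //; rewrite fD; apply: Rmult_le_pos; first by nra.
    by apply: Rlt_le; apply: Rinv_0_lt_compat; nra.
  by rewrite fD; right; field; lra.
have T2 : (1 - wr) * x l / f l * Cmod (e l) <= e' * ((1 - wr) * x l / f l).
  rewrite Rmult_comm; apply: Rmult_le_compat_r => //.
  by apply: Rmult_le_pos; [nra | apply: Rlt_le; apply: Rinv_0_lt_compat].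
(* The gain of the contraction: [x j <= Y] while [f l >= D * Y]. *)
have T3 : (1 - wr) * x j / f l <= / D.
  apply: (Rmult_le_reg_r (f l)) => //.
  have -> : (1 - wr) * x j / f l * f l = (1 - wr) * x j by field; lra.
  apply: (Rmult_le_reg_l D); first by lra.
  have -> : D * (/ D * f l) = f l by field; lra.
  have [DYf _] := f_ge l; have := x_bounds j => xj.
  apply: Rle_trans DYf; apply: Rmult_le_compat_l; first by lra.
  by nra.
have : e' * ((1 - wr) * x j / f l) <= e' * / D by apply: Rmult_le_compat_l; lra.
have -> : e' * ((1 - wr) * x j / f l) =
  e' * ((1 - wr) * (x j - x l) / f l) + e' * ((1 - wr) * x l / f l) by field; lra.
by rewrite -/(Rdiv _ _); lra.
Qed.

Lemma leaf_near eps j l :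
  0 <= eps -> 2 * e' + 6 * eta < 1 ->
  e' / D + 12 * eta <= eps * (1 - (2 * e' + 6 * eta)) ->
  near eps (fc j / RtoC (f j)) (fc l / RtoC (f l)).
Proof.
move=> eps0 small contr.
have f0 c : RtoC (f c) <> RtoC 0.
  by move=> /RtoC_inj; have := f_ge c; nra.
suff [m [Pj [Pl [-> -> P_le Pl_le]]]] : exists m (Pj Pl : C),
    [/\ fc j = (rho m * (RtoC (f j) * (1 + Pj)))%C,
      fc l = (rho m * (RtoC (f l) * (1 + Pl)))%C,
      Cmod (Pj - Pl) <= e' / D + 12 * eta & Cmod Pl <= 2 * e' + 6 * eta].
  have [rho0 _] := rho_near m m.
  have -> : (rho m * (RtoC (f j) * (1 + Pj)) / RtoC (f j) = rho m * (1 + Pj))%C.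
    by field; apply: f0.
  have -> : (rho m * (RtoC (f l) * (1 + Pl)) / RtoC (f l) = rho m * (1 + Pl))%C.
    by field; apply: f0.
  have Pl1 := Cmod_1D_ge Pl.
  split; first by apply: Cmult_neq_0 => // /(f_equal Cmod); rewrite Cmod_0; lra.
  have -> : (rho m * (1 + Pj) - rho m * (1 + Pl) = rho m * (Pj - Pl))%C by ring.
  rewrite !Cmod_mult; have := Cmod_ge_0 (rho m) => rm0.
  have : Cmod (Pj - Pl) <= eps * Cmod (1 + Pl) by nra.
  by nra.
(* The normalising colour [m] is the one of [j], [l] with the larger [x], as [leaf_core] demands. *)
have [xlj|xjl] := Rle_lt_dec (x l) (x j).
  by have [Pj [Pl [? ? ? ? ?]]] := leaf_core xlj; exists j, Pj, Pl.
have [Pl [Pj [? ? le_P ? ?]]] := leaf_core (Rlt_le _ _ xjl).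
exists l, Pj, Pl; split=> //.
by have -> : (Pj - Pl = - (Pl - Pj))%C; [ring | rewrite Cmod_opp].
Qed.

End Contraction.

(** * Comparison of complex and real partition functions by induction on the vertices *)

Lemma rsum_le_update (I : finType) (F G : I -> R) c h :
  (forall i, i != c -> F i = G i) -> F c <= G c + h ->
  \big[Rplus/0]_i F i <= \big[Rplus/0]_i G i + h.
Proof.
move=> eqFG leFG; rewrite (bigD1 c) //= [X in _ <= X + _](bigD1 c) //=.
by rewrite (eq_bigr G) //; lra.
Qed.

Section Comparison.
Variables (V : eqType) (K : finType) (g : rel V).
Variables (wr : V -> V -> R) (wc : V -> V -> C) (D eps eta : R).
Hypotheses (g_sym : symmetric g) (g_irr : irreflexive g).
Hypotheses (wr_sym : forall u v, wr u v = wr v u) (wc_sym : forall u v, wc u v = wc v u).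

Definition close_weights (p : R) (q : C) :=
  [/\ 0 <= p <= 1, Cmod q <= 1 & Cmod (q - RtoC p) <= eta].

Hypothesis w_close : forall u v, g u v -> close_weights (wr u v) (wc u v).
Hypotheses (D1 : 1 <= D) (K2D : 2 * D <= INR #|K|) (eps0 : 0 <= eps) (eta0 : 0 <= eta).
Hypothesis small : forall n, INR n <= D -> 2 * ((1 + eps) ^ n - 1) + 6 * eta < 1.
Hypothesis contraction : forall n, INR n <= D - 1 ->
  ((1 + eps) ^ n - 1) / D + 12 * eta <= eps * (1 - (2 * ((1 + eps) ^ n - 1) + 6 * eta)).

Implicit Types (s t : seq V) (ar : V -> K -> R) (ac : V -> K -> C) (P : pred V).

Local Notation Zr := (@rpf V K g wr).
Local Notation Zc := (@cpf V K g wc).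

(* [m] bounds the degree of [v] in [s] plus the number of pinned neighbours
   already absorbed into the activities at [v]. *)
Definition admissible (m : R) s ar ac v :=
  [/\ forall c, 0 <= ar v c <= 1 /\ Cmod (ac v c) <= 1,
      \big[Rplus/0]_c (1 - ar v c) + INR (count (g v) s) <= m &
      \big[Rplus/0]_c Cmod (ac v c - RtoC (ar v c)) + eta * INR (count (g v) s)
        <= eta * m].

Lemma admissible_le m m' s ar ac v :
  m <= m' -> admissible m s ar ac v -> admissible m' s ar ac v.
Proof. by move=> mm' [a01 mr mc]; split=> //; nra. Qed.

(** A leaf at [v] changes one activity only: its real value drops by at most 1 and its complex error
    grows by at most [eta]. So it uses one unit of the budget [m], the unit freed in
    [admissible_rem] by deleting a neighbour. *)
Lemma admissible_attach m s ar ac v Wr Wc P c :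
  (P v -> close_weights (Wr v) (Wc v)) -> admissible m s ar ac v ->
  admissible (m + if P v then 1 else 0) s (rattach Wr P c ar) (cattach Wc P c ac) v.
Proof.
rewrite /rattach /cattach /attach /=.
case: ifP => [Pv /(_ isT) [W01 W1 Wcr]|Pv _] [a01 mr mc]; last first.
  by rewrite Rplus_0_r /admissible Pv; split.
rewrite /admissible Pv; split=> /= [x||].
- have [ar01 ac1] := a01 x; case: eqP => //= _.
  by rewrite Cmod_mult; have := Cmod_ge_0 (Wc v); have := Cmod_ge_0 (ac v x); split; nra.
- apply: Rle_trans (_ : (\big[Rplus/0]_x (1 - ar v x) + 1) + INR (count (g v) s) <= _).
    apply: Rplus_le_compat_r; apply: (@rsum_le_update _ _ _ c) => [x /negbTE->//|].
    by rewrite eqxx /=; have [] := a01 c; nra.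
  by lra.
apply: Rle_trans (_ : (\big[Rplus/0]_x Cmod (ac v x - RtoC (ar v x)) + eta) +
                       eta * INR (count (g v) s) <= _); last by lra.
apply: Rplus_le_compat_r; apply: (@rsum_le_update _ _ _ c) => [x /negbTE->//|].
rewrite eqxx /=; have [ar01 ac1] := a01 c.
have -> : (ac v c * Wc v - RtoC (ar v c * Wr v) =
  ac v c * (Wc v - RtoC (Wr v)) + RtoC (Wr v) * (ac v c - RtoC (ar v c)))%C.
  by rewrite RtoC_mult; ring.
apply: Rle_trans (Cmod_triangle _ _) _.
rewrite Cmod_mult Cmod_RtoC_mul; last by lra.
have := Cmod_ge_0 (ac v c); have := Cmod_ge_0 (ac v c - RtoC (ar v c)).
have := Cmod_ge_0 (Wc v - RtoC (Wr v)).
move: (Cmod (Wc v - _)) (Cmod (ac v c)) (Cmod (ac v c - _)) Wcr ac1 => p q r *.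
by have : q * p <= eta; [nra | have : Wr v * r <= r; [nra | lra]].
Qed.

Lemma count_rem_mem u s v : u \in s ->
  INR (count (g v) s) = INR (count (g v) (rem u s)) + if g v u then 1 else 0.
Proof.
move=> u_s; rewrite (permP (perm_to_rem u_s)) /= plus_INR.
by case: (g v u) => /=; lra.
Qed.

Lemma admissible_rem m u s ar ac v : u \in s -> admissible m s ar ac v ->
  admissible (m - if g v u then 1 else 0) (rem u s) ar ac v.
Proof.
by move=> u_s [a01]; rewrite (count_rem_mem v u_s) => mr mc; split=> //; lra.
Qed.

Definition ratio s ar ac : C := (Zc s ac / RtoC (Zr s ar))%C.

(** The induction hypothesis. Recolouring a leaf at [v] asks for budget [D - 1] because the leaf
    takes the last unit. *)
Definition controlled s := forall ar ac,
  {in s, forall v, admissible D s ar ac v} ->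
  [/\ 0 < Zr s ar, Zc s ac <> RtoC 0 &
      forall v, v \in s -> admissible (D - 1) s ar ac v ->
      forall Wr Wc, close_weights (Wr v) (Wc v) -> forall j l,
      near eps (ratio s (rattach Wr (pred1 v) j ar) (cattach Wc (pred1 v) j ac))
               (ratio s (rattach Wr (pred1 v) l ar) (cattach Wc (pred1 v) l ac))].

Lemma eq_ratio s ar ac ar' ac' :
  {in s, forall v c, ar v c = ar' v c} -> {in s, forall v c, ac v c = ac' v c} ->
  ratio s ar ac = ratio s ar' ac'.
Proof.
move=> eqr eqc; rewrite /ratio /Zc.
by rewrite (eq_pf _ g wc eqc) (eq_rpf g wr eqr).
Qed.

Lemma ratio_neq0 s ar ac : controlled s ->
  {in s, forall v, admissible D s ar ac v} -> ratio s ar ac <> RtoC 0.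
Proof.
move=> ctrl /ctrl[r0 c0 _]; rewrite /ratio /Cdiv.
apply: Cmult_neq_0 => // /(f_equal Cmod); rewrite Cmod_0 Cmod_inv; last first.
  by move=> /RtoC_inj; lra.
rewrite Cmod_R Rabs_pos_eq; last by lra.
by have := Rinv_0_lt_compat _ r0; lra.
Qed.

(* The leaves are recoloured one vertex at a time. *)
Lemma ratio_recolour s t Wr Wc i l : controlled s -> uniq t -> {subset t <= s} ->
  {in t, forall v, close_weights (Wr v) (Wc v)} -> forall ar ac,
  {in s, forall v, admissible (D - if v \in t then 1 else 0) s ar ac v} ->
  near ((1 + eps) ^ (size t) - 1)
    (ratio s (rattach Wr (mem t) i ar) (cattach Wc (mem t) i ac))
    (ratio s (rattach Wr (mem t) l ar) (cattach Wc (mem t) l ac)).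
Proof.
move=> ctrl; elim: t => [|v t IHt] /=.
  move=> _ _ _ ar ac adm.
  rewrite (@eq_ratio s _ _ ar ac) // Rminus_diag; apply: near_refl; apply: ratio_neq0 => // v v_s.
  by apply: admissible_le (adm v v_s); rewrite /=; lra.
move=> /andP[v_t t_uniq] vt_s W_close ar ac adm.
have v_s : v \in s by apply: vt_s; rewrite mem_head.
have t_s : {subset t <= s} by move=> x x_t; apply: vt_s; rewrite in_cons x_t orbT.
have Wt : {in t, forall x, close_weights (Wr x) (Wc x)}.
  by move=> x x_t; apply: W_close; rewrite in_cons x_t orbT.
have Wv : close_weights (Wr v) (Wc v) by apply: W_close; rewrite mem_head.
(* The intermediate configuration has the leaf of [v] coloured [i] and the leaves of [t] coloured
   [l]; [step1] recolours [t], then [step2] recolours [v]. *)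
pose ari := rattach Wr (pred1 v) i ar; pose aci := cattach Wc (pred1 v) i ac.
pose art := rattach Wr (mem t) l ar; pose act := cattach Wc (mem t) l ac.
have step1 := IHt t_uniq t_s Wt ari aci.
have {}step1 : near ((1 + eps) ^ size t - 1)
    (ratio s (rattach Wr (mem t) i ari) (cattach Wc (mem t) i aci))
    (ratio s (rattach Wr (mem t) l ari) (cattach Wc (mem t) l aci)).
  apply: step1 => x x_s.
  have : admissible ((D - if x \in v :: t then 1 else 0) + if pred1 v x then 1 else 0)
           s ari aci x.
    by apply: admissible_attach (adm x x_s) => /eqP->.
  apply: admissible_le; rewrite in_cons /=; have [->|_] := eqVneq x v.
    by rewrite (negbTE v_t) /=; lra.
  by rewrite /=; lra.
have adm_t x : x \in s ->
    admissible ((D - if x \in v :: t then 1 else 0) + if x \in t then 1 else 0)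
      s art act x.
  by move=> x_s; apply: admissible_attach (adm x x_s) => /Wt.
have step2 : near eps
    (ratio s (rattach Wr (pred1 v) i art) (cattach Wc (pred1 v) i act))
    (ratio s (rattach Wr (pred1 v) l art) (cattach Wc (pred1 v) l act)).
  have [|_ _] := ctrl art act; last first.
    apply=> //; apply: admissible_le (adm_t v v_s).
    by rewrite mem_head (negbTE v_t); lra.
  move=> x x_s; apply: admissible_le (adm_t x x_s); rewrite in_cons.
  by case: eqP => _ /=; case: (x \in t); lra.
have pow1 : 1 <= (1 + eps) ^ size t by apply: pow_R1_Rle; lra.
have e1 : 0 <= (1 + eps) ^ size t - 1 by lra.
have -> : (1 + eps) * (1 + eps) ^ size t - 1 =
          (1 + ((1 + eps) ^ size t - 1)) * (1 + eps) - 1 by ring.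
rewrite (@eq_ratio s _ _ (rattach Wr (mem t) i ari) (cattach Wc (mem t) i aci)).
- rewrite (@eq_ratio s (rattach _ _ l _) _ (rattach Wr (pred1 v) l art)
                                           (cattach Wc (pred1 v) l act)).
  + apply: near_trans e1 step1 _.
    rewrite (@eq_ratio s _ _ (rattach Wr (pred1 v) i art) (cattach Wc (pred1 v) i act)) //.
      by move=> x _ c; apply: attachC.
    by move=> x _ c; apply: attachC.
  + by move=> x _ c; apply: attach_cons.
  + by move=> x _ c; apply: attach_cons.
- by move=> x _ c; rewrite /ari rattachC; apply: attach_cons.
- by move=> x _ c; rewrite /aci /cattach attachC; apply: attach_cons.
Qed.

Lemma cpf_rem u s ac : u \in s ->
  Zc s ac = \big[Cplus/RtoC 0]_c (ac u c * Zc (rem u s) (cattach (wc u) (g u) c ac))%C.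
Proof. exact: (pf_rem Cplus Cmult_0_r g_sym wc_sym). Qed.

Lemma cpf_leaf W u s c ac : uniq s -> u \in s ->
  Zc s (cattach W (pred1 u) c ac) =
  (Zc s ac - (1 - W u) * (ac u c * Zc (rem u s) (cattach (wc u) (g u) c ac)))%C.
Proof.
move=> s_uniq u_s; rewrite (cpf_rem ac u_s).
have -> : Zc s (cattach W (pred1 u) c ac) =
    \big[Cplus/RtoC 0]_(d : K) ((if d == c then ac u d * W u else ac u d) *
                           Zc (rem u s) (cattach (wc u) (g u) d ac))%C.
  exact: (pf_leaf Cplus Cmult_0_r g_sym wc_sym).
rewrite (bigD1 c) //= eqxx [X in _ = (X - _)%C](bigD1 c) //=.
rewrite (eq_bigr (fun d => ac u d * Zc (rem u s) (cattach (wc u) (g u) d ac))%C).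
  by ring.
by move=> d /negbTE->.
Qed.

(** Eliminating [u] turns its neighbours into vertices with a leaf of the colour of [u]. Changing
    that colour recolours these leaves, which the hypothesis on [rem u s] controls, and the
    contraction estimate passes this on to a leaf at [u]. *)
Lemma controlled_rem u s : uniq s -> u \in s -> controlled (rem u s) ->
  forall ar ac, {in s, forall v, admissible D s ar ac v} ->
  [/\ 0 < Zr s ar, Zc s ac <> RtoC 0 &
      admissible (D - 1) s ar ac u ->
      forall Wr Wc, close_weights (Wr u) (Wc u) -> forall j l,
      near eps (ratio s (rattach Wr (pred1 u) j ar) (cattach Wc (pred1 u) j ac))
               (ratio s (rattach Wr (pred1 u) l ar) (cattach Wc (pred1 u) l ac))].
Proof.
move=> s_uniq u_s ctrl ar ac adm.
have wr01 x y : g x y -> 0 <= wr x y <= 1 by move=> /w_close[].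
set s' := rem u s; have s'_uniq : uniq s' := rem_uniq u s_uniq.
have s's v : v \in s' -> v \in s by apply: mem_rem.
pose t := filter (g u) s'.
have t_uniq : uniq t by rewrite filter_uniq.
have t_s' : {subset t <= s'} by move=> v; rewrite mem_filter => /andP[].
have t_close : {in t, forall v, close_weights (wr u v) (wc u v)}.
  by move=> v; rewrite mem_filter => /andP[/w_close].
have adm' v : v \in s' -> admissible (D - if v \in t then 1 else 0) s' ar ac v.
  move=> v_s'; have := admissible_rem u_s (adm v (s's v v_s')).
  by rewrite mem_filter v_s' andbT g_sym.
have admD v : v \in s' -> admissible D s' ar ac v.
  by move=> /adm'; apply: admissible_le; case: (v \in t); lra.
have a0 : {in s', forall v c, 0 <= ar v c}.
  by move=> v /admD[a01 _ _] c; have [] := a01 c; lra.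
pose Y := Zr s' ar; have [Y0 _ _] := ctrl ar ac admD; rewrite -/Y in Y0.
pose br c := rattach (wr u) (g u) c ar; pose bc c := cattach (wc u) (g u) c ac.
have adm_b c : {in s', forall v, admissible D s' (br c) (bc c) v}.
  move=> v v_s'.
  have : admissible ((D - if v \in t then 1 else 0) + if g u v then 1 else 0)
           s' (br c) (bc c) v.
    by apply: admissible_attach (adm' v v_s'); apply: w_close.
  by apply: admissible_le; rewrite mem_filter v_s' andbT; case: (g u v); lra.
pose yr c := Zr s' (br c); pose rho c := ratio s' (br c) (bc c).
have yr0 c : 0 < yr c by have [] := ctrl _ _ (adm_b c).
have yrY c : 0 <= yr c <= Y.
  split; first by have := yr0 c; lra.
  by apply: rpf_attach_le => // v _; apply: wr01.
have ycE c : Zc s' (bc c) = (rho c * RtoC (yr c))%C.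
  rewrite /rho /ratio -/(yr c); field => /RtoC_inj; have := yr0 c; lra.
have size_t : INR (size t) = INR (count (g u) s).
  by rewrite size_filter (count_rem_mem u u_s) g_irr Rplus_0_r.
have eq_t A one (mul : @Monoid.com_law A one) W c (a : V -> K -> A) :
    {in s', forall v x, attach mul W (g u) c a v x = attach mul W (mem t) c a v x}.
  by move=> v v_s' x; rewrite /attach /= mem_filter v_s' andbT.
have rho_near c d : near ((1 + eps) ^ size t - 1) (rho c) (rho d).
  rewrite /rho (@eq_ratio s' (br c) (bc c) (rattach (wr u) (mem t) c ar)
                                           (cattach (wc u) (mem t) c ac)).
  - rewrite (@eq_ratio s' (br d) (bc d) (rattach (wr u) (mem t) d ar)
                                        (cattach (wc u) (mem t) d ac)).
    + exact: ratio_recolour.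
    + exact: eq_t.
    + exact: eq_t.
  - exact: eq_t.
  - exact: eq_t.
have [a01 _ ac_ar] := adm u u_s.
have ar01 c : 0 <= ar u c <= 1 by have [] := a01 c.
have ac1 c : Cmod (ac u c) <= 1 by have [] := a01 c.
have {}ac_ar : \big[Rplus/0]_c Cmod (ac u c - RtoC (ar u c)) <= D * eta.
  by have := Rmult_le_pos _ _ eta0 (pos_INR (count (g u) s)); lra.
have XE : Zr s ar = \big[Rplus/0]_c (ar u c * yr c) by apply: rpf_rem.
have XcE : Zc s ac = \big[Cplus/RtoC 0]_c (ac u c * (rho c * RtoC (yr c)))%C.
  by rewrite (cpf_rem ac u_s); apply: eq_bigr => c _; rewrite -ycE.
(* Each of the at least [2 * D] colours would contribute [Y]. The defects of the activities at [u]
   and the leaves on its neighbours cost at most [m * Y] in total, the latter by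
   [rpf_attach_sum]. *)
have X_ge m : admissible m s ar ac u -> (2 * D - m) * Y <= \big[Rplus/0]_c (ar u c * yr c).
  move=> [_ am _].
  have := rpf_attach_sum g_sym wr_sym wr01 s'_uniq t_uniq t_s'
            (fun v v_t => let: And3 h _ _ := t_close v v_t in h) a0.
  rewrite size_t -/Y => sum_le.
  have : \big[Rplus/0]_c (Y - ar u c * yr c) <=
         \big[Rplus/0]_c ((1 - ar u c) * Y + (Y - yr c)).
    by apply: rsum_le => c _; have := yrY c; have := ar01 c; nra.
  rewrite rsumD rsumB rsum_const.
  have -> : \big[Rplus/0]_c ((1 - ar u c) * Y) = Y * \big[Rplus/0]_c (1 - ar u c).
    by rewrite rsumM; apply: eq_bigr => c _; rewrite Rmult_comm.
  have -> : \big[Rplus/0]_c (Y - yr c) =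
            \big[Rplus/0]_c (Y - Zr s' (rattach (wr u) (mem t) c ar)).
    by apply: eq_bigr => c _; congr (_ - _); apply: eq_rpf; apply: eq_t.
  by nra.
have INRt m : admissible m s ar ac u -> INR (size t) <= m.
  move=> [_ am _]; rewrite size_t; have : 0 <= \big[Rplus/0]_c (1 - ar u c).
    by apply: rsum_ge0 => c _; have := ar01 c; lra.
  by lra.
have e'_ge0 : 0 <= (1 + eps) ^ size t - 1.
  by have := pow_R1_Rle (1 + eps) (size t); lra.
have sm := small (INRt D (adm u u_s)).
have e'01 : 0 <= (1 + eps) ^ size t - 1 <= 1 by lra.
have XD := X_ge D (adm u u_s).
have [c0] : exists c : K, true.
  case: (pickP (fun _ : K => true)) => [c _|]; first by exists c.
  by move=> /eq_card0 K0; have := K2D; rewrite K0 /=; lra.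
move=> _; split.
- by rewrite XE; apply: Rlt_le_trans XD; apply: Rmult_lt_0_compat; lra.
- rewrite XcE; apply: (@perturbed_sum_neq0 _ _ yr _ rho D Y eta _ _ Y0 eta0 e'01
                         ar01 ac_ar yrY rho_near c0) => //; lra.
move=> adm1 Wr Wc [W01 W1 Wcr] j l.
rewrite /ratio !cpf_leaf // !(rpf_leaf g_sym wr_sym) // -/s' -/(br j) -/(br l) -/(bc j) -/(bc l).
rewrite !ycE XE XcE.
apply: (@leaf_near _ _ yr _ rho D Y eta ((1 + eps) ^ size t - 1)) => //.
(* Budget [D - 1] gives [X >= (D + 1) * Y], which leaves [D * Y] after removing one term
   [x c <= Y]. *)
- move=> c; have := X_ge _ adm1; have := ar01 c; have := yrY c; nra.
- by apply: contraction; apply: INRt.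
Qed.

(** Strong induction on the size. Eliminating the head gives nonvanishing, and a leaf at [v] is
    treated by eliminating [v] itself. *)
Lemma all_controlled s : uniq s -> controlled s.
Proof.
have [n] := ubnP (size s); elim: n s => // n IHn s s_n s_uniq ar ac adm.
have ctrl u : u \in s -> controlled (rem u s).
  move=> u_s; apply: IHn; last exact: rem_uniq.
  by rewrite size_rem //; case: (s) u_s s_n.
case: s s_n s_uniq adm ctrl => [|u s] s_n s_uniq adm ctrl.
  split=> //; first by rewrite /rpf /=; lra.
  by move=> /RtoC_inj; lra.
have u_s := mem_head u s.
have [r0 c0 _] := controlled_rem s_uniq u_s (ctrl u u_s) adm.
split=> // v v_s; by have [_ _ h] := controlled_rem s_uniq v_s (ctrl v v_s) adm.
Qed.

(** With all activities 1 the defects vanish, so admissibility reduces to the degree bound. *)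
Lemma cpf_neq0 s : uniq s -> {in s, forall v, INR (count (g v) s) <= D} ->
  Zc s (fun _ _ => RtoC 1) <> RtoC 0.
Proof.
move=> s_uniq deg.
have [] // := @all_controlled s s_uniq (fun _ _ => 1) (fun _ _ => RtoC 1).
move=> v v_s; have degv := deg v v_s; split=> [c||].
- by rewrite Cmod_1; lra.
- by rewrite big1 => [|c _]; lra.
- rewrite big1 => [|c _]; first by nra.
  by have -> : (RtoC 1 - RtoC 1 = RtoC 0)%C; [ring | rewrite Cmod_0].
Qed.

End Comparison.

(** * Choice of the error bounds *)

(** With [y = INR n * x], Bernoulli-type induction bounds the power by [1 / (1 - y)], and
    [1 / (1 - y) <= 1 + y + 2 * y ^ 2] for [0 <= y <= 1 / 2]. *)
Lemma pow_1D_le x n : 0 <= x -> INR n * x <= 1 / 2 ->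
  (1 + x) ^ n - 1 <= INR n * x * (1 + 2 * (INR n * x)).
Proof.
move=> x0 small.
have inv m : (1 + x) ^ m * (1 - INR m * x) <= 1.
  elim: m => [|m IHm]; first by rewrite /=; lra.
  rewrite S_INR -tech_pow_Rmult; have p0 : 0 <= (1 + x) ^ m by apply: pow_le; lra.
  have m0 := pos_INR m; apply: Rle_trans IHm.
  have -> : (1 + x) * (1 + x) ^ m * (1 - (INR m + 1) * x) =
            (1 + x) ^ m * ((1 + x) * (1 - (INR m + 1) * x)) by ring.
  by apply: Rmult_le_compat_l => //; nra.
have := inv n; have y0 : 0 <= INR n * x by apply: Rmult_le_pos => //; apply: pos_INR.
move: (INR n * x) ((1 + x) ^ n) y0 small => y q y0 y2 qy.
apply: (Rmult_le_reg_r (1 - y)); first by lra.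
have : 0 <= y * y * (1 - 2 * y) by apply: Rmult_le_pos; nra.
by nra.
Qed.

(** The factor [(D - 1) / D] leaves a slack of about [eps / D]. Second-order terms in [D * eps] must
    stay below [1 / D], hence [eps] of order [D ^ -2]; then [eta] of order [D ^ -3] fits into the
    slack. *)
Definition leaf_error (D : R) := / (16 * D ^ 2).
Definition weight_error (D : R) := / (400 * D ^ 3).

Section Errors.
Variable D : R.
Hypothesis D1 : 1 <= D.
Let r := / D.
Local Notation eps := (leaf_error D).
Local Notation eta := (weight_error D).

Lemma errors_inv : [/\ 0 < r <= 1, eps = r ^ 2 / 16, eta = r ^ 3 / 400 & D * r = 1].
Proof.
split; try by rewrite /leaf_error /weight_error /r; field; lra.
split; first by apply: Rinv_0_lt_compat; lra.
by rewrite -Rinv_1; apply: Rinv_le_contravar; lra.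
Qed.

Lemma small_errors n : INR n <= D -> 2 * ((1 + eps) ^ n - 1) + 6 * eta < 1.
Proof.
have [r01 epsE etaE Dr] := errors_inv => nD.
have eps0 : 0 < eps by rewrite epsE; nra.
have ne : INR n * eps <= r / 16.
  apply: Rle_trans (_ : D * eps <= _); first by apply: Rmult_le_compat_r; lra.
  rewrite epsE; have -> : D * (r ^ 2 / 16) = (D * r) * (r / 16) by field.
  by rewrite Dr; lra.
have n0 : 0 <= INR n * eps by apply: Rmult_le_pos; [apply: pos_INR | lra].
have := @pow_1D_le eps n; have r3 : r ^ 3 <= 1 by nra.
by move=> /(_ (Rlt_le _ _ eps0)) le_pow; have {}le_pow := le_pow ltac:(lra); nra.
Qed.

Lemma contraction_errors n : INR n <= D - 1 ->
  ((1 + eps) ^ n - 1) / D + 12 * eta <= eps * (1 - (2 * ((1 + eps) ^ n - 1) + 6 * eta)).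
Proof.
have [r01 epsE etaE Dr] := errors_inv => nD.
have eps0 : 0 < eps by rewrite epsE; nra.
have ne : INR n * eps <= r * (1 - r) / 16.
  apply: Rle_trans (_ : (D - 1) * eps <= _); first by apply: Rmult_le_compat_r; lra.
  rewrite epsE; have -> : (D - 1) * (r ^ 2 / 16) = (D * r - r) * (r / 16) by field.
  by rewrite Dr; lra.
have n0 : 0 <= INR n * eps by apply: Rmult_le_pos; [apply: pos_INR | lra].
have ne2 : INR n * eps <= 1 / 2 by nra.
have := pow_1D_le (Rlt_le _ _ eps0) ne2.
set q := (1 + eps) ^ n - 1 => q_le.
have {}q_le : q <= r * (1 - r) / 16 * (1 + r / 8).
  by apply: Rle_trans q_le _; apply: Rmult_le_compat; nra.
have q2 : 2 * q <= r / 7 by nra.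
have qD : q / D <= r ^ 2 / 16 * ((1 - r) * (1 + r / 8)).
  rewrite /Rdiv -/r; have : q * r <= r * (1 - r) / 16 * (1 + r / 8) * r.
    by apply: Rmult_le_compat_r; lra.
  by move=> h; apply: Rle_trans h _; right; field.
apply: Rle_trans (_ : r ^ 2 / 16 * (1 - (r / 7 + 6 * eta)) <= _); last first.
  by rewrite epsE; apply: Rmult_le_compat_l; nra.
rewrite etaE in q_le *.
(* The term [192 / 400 * r] is [12 * eta] after factoring out [eps = r ^ 2 / 16]. *)
apply: Rle_trans (_ : r ^ 2 / 16 * ((1 - r) * (1 + r / 8) + 192 / 400 * r) <= _).
  by nra.
by apply: Rmult_le_compat_l; nra.
Qed.

End Errors.

(** * The zero-free region and the Potts model *)

(* A thickening of [0,1) inside the open unit disc, so that products of weights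
   stay bounded by 1. *)
Definition zero_free_region (eta : R) (z : Cplx) : Prop :=
  [/\ Cmod z < 1, Rabs (snd z) < eta / 2 & - (eta / 2) < fst z].

Lemma Cmod_lt_1 z : Cmod z < 1 -> fst z < 1.
Proof.
by move=> z1; have := re_le_Cmod z; have := Rle_abs (fst z); rewrite /Re; lra.
Qed.

Lemma zero_free_region_open eta : C_open (zero_free_region eta).
Proof.
move=> z [z1 z2 z3].
pose m := Rmin (1 - Cmod z) (Rmin (eta / 2 - Rabs (snd z)) (fst z + eta / 2)).
exists m; split=> [|z' z'z]; first by do 2?apply: Rmin_glb_lt; lra.
have m1 : m <= 1 - Cmod z by apply: Rmin_l.
have m2 : m <= eta / 2 - Rabs (snd z) by apply: Rle_trans (Rmin_r _ _) (Rmin_l _ _).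
have m3 : m <= fst z + eta / 2 by apply: Rle_trans (Rmin_r _ _) (Rmin_r _ _).
have {}z'z : Cmod (z' - z) < m by [].
have := Rmax_Cmod (z' - z)%C.
have := Rmax_l (Rabs (fst (z' - z)%C)) (Rabs (snd (z' - z)%C)).
have := Rmax_r (Rabs (fst (z' - z)%C)) (Rabs (snd (z' - z)%C)).
rewrite /= => im re mx; split.
- have := Cmod_triangle (z' - z) z.
  by have -> : (z' - z + z = z')%C by [ring]; lra.
- have := Rabs_triang (snd z' + - snd z) (snd z).
  by have -> : snd z' + - snd z + snd z = snd z' by [ring]; lra.
- have := Rle_abs (- (fst z' + - fst z)); rewrite Rabs_Ropp; lra.
Qed.

(** The real companion of [z] is its real part clipped at 0; the clipping and the imaginary part
    each cost at most [eta / 2]. *)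
Lemma zero_free_region_close eta z : zero_free_region eta z ->
  close_weights eta (Rmax 0 (fst z)) z.
Proof.
move=> [z1 z2 z3]; have re1 := Cmod_lt_1 z1; split.
- by split; [apply: Rmax_l | apply: Rmax_lub; lra].
- by lra.
have -> : (z - RtoC (Rmax 0 (fst z)) =
           RtoC (fst z - Rmax 0 (fst z)) + Ci * RtoC (snd z))%C.
  by apply: injective_projections => /=; ring.
apply: Rle_trans (Cmod_triangle _ _) _.
rewrite Cmod_mult !Cmod_R Cmod_Ci Rmult_1_l.
have : Rabs (fst z - Rmax 0 (fst z)) <= eta / 2; last by lra.
apply: Rabs_le; have := Rabs_pos (snd z).
by rewrite /Rmax; case: Rle_dec => ? ?; lra.
Qed.

Lemma potts_Z_neq0 (D n k : nat) (g : rel 'I_n) (w : 'I_n -> 'I_n -> Cplx) :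
  (1 <= D)%N -> simple_graph g -> max_deg_le g D -> (2 * D <= k)%N ->
  (forall u v, g u v -> zero_free_region (weight_error (INR D)) (w u v)) ->
  potts_Z g k w <> C0.
Proof.
move=> D1 [g_irr g_sym] deg Dk w_U.
have D1R : 1 <= INR D by apply: (le_INR 1); apply/leP.
have k0 : (0 < k)%N by apply: leq_trans Dk; rewrite muln_gt0.
(* [potts_Z] reads [w u v] for [u < v]; reflecting these values gives the symmetric weights that
   vertex elimination requires. *)
pose w' (u v : 'I_n) : C := if (u < v)%N then w u v else w v u.
have w'_U u v : g u v -> zero_free_region (weight_error (INR D)) (w' u v).
  by rewrite /w'; case: ifP => _ guv; apply: w_U; rewrite // g_sym.
have w'_sym u v : w' u v = w' v u.
  rewrite /w'; case: ltngtP => // /ord_inj->; by [].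
have -> : potts_Z g k w =
    cpf g w' (enum 'I_n) (fun _ (_ : 'I_k) => RtoC 1).
  rewrite /cpf -(pf_enum _ Cmult_0_r _ _ (Ordinal k0)); apply: eq_bigr => phi _.
  by apply: eq_bigr => p /and3P[_ lt_p _]; rewrite /w' lt_p.
have [r01 epsE etaE _] := errors_inv D1R.
apply: (@cpf_neq0 _ _ g (fun u v => Rmax 0 (fst (w' u v))) w' (INR D)
          (leaf_error (INR D)) (weight_error (INR D))) => //.
- by move=> u v; rewrite w'_sym.
- by move=> u v /w'_U; apply: zero_free_region_close.
- rewrite card_ord; have -> : 2 * INR D = INR (2 * D)%N by rewrite mult_INR.
  by apply: le_INR; apply/leP.
- by rewrite epsE; nra.
- by rewrite etaE; have := pow_lt _ 3 (proj1 r01); lra.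
- exact: small_errors.
- exact: contraction_errors.
- exact: enum_uniq.
move=> v _; apply: le_INR; apply/leP; apply: leq_trans (deg v).
by rewrite cardE -size_filter enumT /enum_mem.
Qed.

Theorem theorem1p1 :
  forall D : nat, (1 <= D)%N ->
  exists c : R,
    c <= exp 1 /\
    (D = 3%N -> c <= 1485 / 1000) /\
    (D = 4%N -> c <= 1749 / 1000) /\
    (D = 5%N -> c <= 1939 / 1000) /\
    (D = 6%N -> c <= 2081 / 1000) /\
    (D = 7%N -> c <= 2193 / 1000) /\
    (D = 8%N -> c <= 2283 / 1000) /\
    (D = 9%N -> c <= 2357 / 1000) /\
    (D = 10%N -> c <= 2419 / 1000) /\
    (D = 11%N -> c <= 2472 / 1000) /\
    (D = 12%N -> c <= 2517 / 1000) /\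
    exists U : Cplx -> Prop,
      C_open U /\
      (forall x : R, 0 <= x < 1 -> U (x, 0)) /\
      forall (n : nat) (g : rel 'I_n) (k : nat) (w : 'I_n -> 'I_n -> Cplx),
        simple_graph g ->
        max_deg_le g D ->
        c * INR D + 1 <= INR k ->
        (forall u v : 'I_n, g u v -> U (w u v)) ->
        potts_Z g k w <> C0.
Proof.
move=> D D1; have D1R : 1 <= INR D by apply: (le_INR 1); apply/leP.
(* Chosen so that [c * D + 1] lies strictly between [2 * D - 1] and [2 * D]. *)
exists (2 - 19 / 10 / INR D).
have r0 : 0 < / INR D by apply: Rinv_0_lt_compat; lra.
have c2 : 2 - 19 / 10 / INR D <= 2 by rewrite /Rdiv; lra.
split; first by have := exp_ineq1 1; lra.
(* For [D] equal to 3, 4, 5 the required bound is below 2 and [c] is evaluated; from 6 on it exceeds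
   2 and [c <= 2] suffices. *)
do 3 (split; first by move=> ->; rewrite /=; lra).
do 7 (split; first by move=> _; lra).
exists (zero_free_region (weight_error (INR D))); split.
  exact: zero_free_region_open.
have eta0 : 0 < weight_error (INR D).
  by apply: Rinv_0_lt_compat; have := pow_lt (INR D) 3; lra.
split=> [x x01|n g k w g_simple deg ck w_U].
  split; rewrite /= ?Rabs_R0; try lra.
  by rewrite -/(RtoC x) Cmod_R Rabs_pos_eq; lra.
apply: (potts_Z_neq0 D1 g_simple deg _ w_U).
have : (2 - 19 / 10 / INR D) * INR D + 1 = 2 * INR D - 9 / 10 by field; lra.
move=> cE; rewrite cE in ck; rewrite leqNgt; apply/negP => /leP/le_INR.
by rewrite S_INR mult_INR /=; lra.
Qed.
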